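(* Let $\mu$ be an atomless measure and let $T\colon L^1(\mu)\to L^1(\mu)$ be a weakly compact bounded linear operator. Then $$\|\mathrm{Id}+T\| = 1+\|T\|.$$
   Context: Scalars are real: $L^1(\mu)$ is the real Banach space of (classes of) $\mu$-integrable real functions with its usual norm, and it is assumed to be nonzero. A measure $\mu$ is atomless if it has no atoms, an atom being a measurable set $A$ with $\mu(A)>0$ such that every measurable $B\subset A$ satisfies $\mu(B)=0$ or $\mu(A\setminus B)=0$. $\mathrm{Id}$ is the identity operator and operators carry the operator norm. A bounded linear operator is weakly compact if it maps the closed unit ball to a relatively weakly compact set. *)

(* Defs.v *)
From HB Require Import structures.
From mathcomp Require Import all_boot all_order all_algebra.
From mathcomp Require Import all_classical all_reals all_analysis.
From mathcomp Require Import measurable_realfun ess_sup_inf.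

Set Implicit Arguments.
Unset Strict Implicit.
Unset Printing Implicit Defensive.
Import Order.TTheory GRing.Theory Num.Theory.
Import numFieldNormedType.Exports.
Local Open Scope classical_set_scope.
Local Open Scope ring_scope.

(* The library's [LspaceType mu p1] is the type of almost-everywhere classes of
   functions with finite ['N[mu]_p] norm, without algebraic structure.  The
   vector space operations on representatives ([LfunType mu p1]) are transported
   to the classes, and the p-norm makes [LspaceType mu p1] a [normedModType R].
   L^1(mu) is the instance [LspaceType1 mu]. *)
Section Lspace_normedModType.
Context d (T : measurableType d) (R : realType).
Variables (mu : {measure set T -> \bar R}) (p : \bar R) (p1 : (1 <= p)%E).

Local Notation Lfn := (LfunType mu p1).
Local Notation Lsp := (LspaceType mu p1).

Lemma ae_eq_Lnorm (f g : T -> R) :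
  measurable_fun setT f -> measurable_fun setT g ->
  f = g %[ae mu] -> ('N[mu]_p[EFin \o f] = 'N[mu]_p[EFin \o g])%E.
Proof.
have mN (h : T -> R) (r : R) : measurable_fun setT h ->
    measurable_fun setT (fun x => `|(h x)%:E| `^ r : \bar R)%E.
  move=> mh; have mH : measurable_fun setT (fun x => `|(h x)%:E| : \bar R)%E.
    by apply: measurableT_comp => //; exact/measurable_EFinP.
  exact: (measurableT_comp (measurable_poweR r) mH).
move=> mf mg fg; rewrite unlock /Lnorm; case: p p1 => [r _|_|//].
- congr (_ `^ _)%E; apply: ae_eq_integral => //; [exact: mN|exact: mN|].
  by apply: filterS fg => x /= fg _; rewrite fg.
- case: ifPn => // mu0; apply: eq_ess_sup.
  by apply: filterS fg => x /= ->.
Qed.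

Lemma Lspace_Lfun (f : Lsp) : (f : T -> R) \in Lfun mu p.
Proof.
rewrite inE; apply/andP; split; rewrite inE /=.
  exact: (measurable_funPT (repr (f : {mfun_ mu, T >-> measurableTypeR R}))).
exact: Lebesgue_finite.
Qed.

Definition Lspace_repr (f : Lsp) : Lfn := Lfun_Sub p1 (Lspace_Lfun f).

Let mfun_of (f : Lfn) : {mfun T >-> measurableTypeR R} :=
  HB.pack_for {mfun T >-> measurableTypeR R} (f : T -> measurableTypeR R)
    (@isMeasurableFun.Build _ _ T (measurableTypeR R) f (measurable_funPT f)).

Let cls (f : Lfn) : {mfun_ mu, T >-> measurableTypeR R} :=
  \pi_({mfun_ mu, T >-> measurableTypeR R})%qT (mfun_of f).

Let clsE f : (cls f : T -> R) = f %[ae mu].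
Proof. by have /eqmodP/asboolP := reprK (cls f). Qed.

Let cls_finite f : finite_norm mu p (cls f).
Proof.
rewrite /finite_norm (ae_eq_Lnorm _ _ (clsE f)).
- exact: Lfunction_finite.
- exact: (measurable_funPT (repr (cls f))).
- exact: measurable_funPT.
Qed.

Definition Lspace_class (f : Lfn) : Lsp :=
  HB.pack_for Lsp (cls f) (isFinLebesgue.Build _ _ _ mu p p1 _ (cls_finite f)).

Lemma Lspace_classE f : (Lspace_class f : T -> R) = f %[ae mu].
Proof. exact: clsE. Qed.

Lemma LspaceP (f g : Lsp) : f = g <-> (f : T -> R) = g %[ae mu].
Proof.
split=> [-> //|]; first exact/aeW.
move=> fg; have : f = g :> {mfun_ mu, T >-> measurableTypeR R}.
  by rewrite -[LHS]reprK -[RHS]reprK; apply/eqmodP/asboolP.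
move: f g {fg} => [f [[pf]]] [g [[pg]]] /= fg; case: _ / fg in pg *.
by rewrite (Prop_irrelevance pf pg).
Qed.

Definition Lspace_zero : Lsp := Lspace_class 0.
Definition Lspace_opp (f : Lsp) : Lsp := Lspace_class (- Lspace_repr f).
Definition Lspace_add (f g : Lsp) : Lsp :=
  Lspace_class (Lspace_repr f + Lspace_repr g).
Definition Lspace_scale (a : R) (f : Lsp) : Lsp :=
  Lspace_class (a *: Lspace_repr f).
Definition Lspace_norm (f : Lsp) : R := fine 'N[mu]_p[EFin \o f].

Let classE (f : Lfn) : \forall x \ae mu, Lspace_class f x = f x.
Proof. by apply: filterS (Lspace_classE f) => x; exact. Qed.

Let LspaceE (f g : Lsp) : (\forall x \ae mu, f x = g x) -> f = g.
Proof. by move=> fg; apply/LspaceP; apply: filterS fg => x ->. Qed.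

Let zeroE : \forall x \ae mu, Lspace_zero x = 0.
Proof. exact: classE. Qed.

Let oppE f : \forall x \ae mu, Lspace_opp f x = - f x.
Proof. exact: classE. Qed.

Let addE f g : \forall x \ae mu, Lspace_add f g x = f x + g x.
Proof. exact: classE. Qed.

Let scaleE a f : \forall x \ae mu, Lspace_scale a f x = a * f x.
Proof. exact: classE. Qed.

Let addA : associative Lspace_add.
Proof.
move=> f g h; apply: LspaceE; near=> x.
rewrite (near (addE f (Lspace_add g h)) x)// (near (addE g h) x)//.
by rewrite (near (addE (Lspace_add f g) h) x)// (near (addE f g) x)// addrA.
Unshelve. all: by end_near. Qed.

Let addC : commutative Lspace_add.
Proof.
move=> f g; apply: LspaceE; near=> x.
by rewrite (near (addE f g) x)// (near (addE g f) x)// addrC.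
Unshelve. all: by end_near. Qed.

Let add0 : left_id Lspace_zero Lspace_add.
Proof.
move=> f; apply: LspaceE; near=> x.
by rewrite (near (addE Lspace_zero f) x)// (near zeroE x)// add0r.
Unshelve. all: by end_near. Qed.

Let addN : left_inverse Lspace_zero Lspace_opp Lspace_add.
Proof.
move=> f; apply: LspaceE; near=> x.
rewrite (near (addE (Lspace_opp f) f) x)// (near (oppE f) x)//.
by rewrite (near zeroE x)// addNr.
Unshelve. all: by end_near. Qed.

HB.instance Definition _ := gen_eqMixin Lsp.
HB.instance Definition _ := gen_choiceMixin Lsp.
HB.instance Definition _ := GRing.isZmodule.Build Lsp addA addC add0 addN.

Let scaleA a b f :
  Lspace_scale a (Lspace_scale b f) = Lspace_scale (a * b) f.
Proof.
apply: LspaceE; near=> x.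
rewrite (near (scaleE a (Lspace_scale b f)) x)// (near (scaleE b f) x)//.
by rewrite (near (scaleE (a * b) f) x)// mulrA.
Unshelve. all: by end_near. Qed.

Let scale1 : left_id 1 Lspace_scale.
Proof.
move=> f; apply: LspaceE; near=> x.
by rewrite (near (scaleE 1 f) x)// mul1r.
Unshelve. all: by end_near. Qed.

Let scaleDr : right_distributive Lspace_scale +%R.
Proof.
move=> a f g; apply: LspaceE; near=> x.
rewrite (near (scaleE a (f + g)) x)// (near (addE f g) x)//.
rewrite (near (addE (Lspace_scale a f) (Lspace_scale a g)) x)//.
by rewrite (near (scaleE a f) x)// (near (scaleE a g) x)// mulrDr.
Unshelve. all: by end_near. Qed.

Let scaleDl f : {morph Lspace_scale ^~ f : a b / a + b}.
Proof.
move=> a b; apply: LspaceE; near=> x.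
rewrite (near (scaleE (a + b) f) x)//.
rewrite (near (addE (Lspace_scale a f) (Lspace_scale b f)) x)//.
by rewrite (near (scaleE a f) x)// (near (scaleE b f) x)// mulrDl.
Unshelve. all: by end_near. Qed.

HB.instance Definition _ := GRing.Zmodule_isLmodule.Build R Lsp
  scaleA scale1 scaleDr scaleDl.

Let norm_class (f : Lfn) :
  Lspace_norm (Lspace_class f) = fine 'N[mu]_p[EFin \o f].
Proof.
congr fine; apply: ae_eq_Lnorm; last exact: Lspace_classE.
  exact: (measurable_funPT (Lspace_repr (Lspace_class f))).
exact: measurable_funPT.
Qed.

Let ler_normD (f g : Lsp) :
  Lspace_norm (f + g) <= Lspace_norm f + Lspace_norm g.
Proof. by rewrite norm_class; exact: ler_LnormD. Qed.

Let normrZ (a : R) (f : Lsp) :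
  Lspace_norm (a *: f) = `|a| * Lspace_norm f.
Proof.
rewrite norm_class; apply: EFin_inj; rewrite EFinM.
rewrite (finite_norm_fine (a *: Lspace_repr f)).
by rewrite (finite_norm_fine (Lspace_repr f)) -LnormZ.
Qed.

Let normr0_eq0 (f : Lsp) : Lspace_norm f = 0 -> f = 0.
Proof.
move=> /(@fine_Lnormr_eq0 _ _ _ _ _ p1 (Lspace_repr f)) f0.
apply: LspaceE; near=> x; rewrite (near zeroE x)//.
by have /= -> := near f0 x.
Unshelve. all: by end_near. Qed.

HB.instance Definition _ := Lmodule_isNormed.Build R Lsp
  ler_normD normrZ normr0_eq0.

Lemma LspaceDE (f g : Lsp) : \forall x \ae mu, (f + g : Lsp) x = f x + g x.
Proof. exact: addE. Qed.

Lemma LspaceZE (a : R) (f : Lsp) :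
  \forall x \ae mu, (a *: f : Lsp) x = a * f x.
Proof. exact: scaleE. Qed.

Lemma Lspace_normE (f : Lsp) : `|f| = fine 'N[mu]_p[EFin \o f].
Proof. by []. Qed.

End Lspace_normedModType.

Lemma LspaceType1_norm d (T : measurableType d) (R : realType)
  (mu : {measure set T -> \bar R}) (f : LspaceType1 mu) :
  `|f| = \int[mu]_x `|f x|.
Proof. by rewrite Lspace_normE Lnorm1. Qed.

Section operators.
Context {R : realType}.

Definition dual (E : normedModType R) : Type :=
  {phi : {linear E -> R^o} | continuous phi}.

(* The coarsest topology on [E] for which all elements of [dual E] are
   continuous. *)
Definition weak (E : normedModType R) : topologicalType :=
  sup_topology (fun phi : dual E =>
    Topological.class (initial_topology (sval phi : E -> R^o))).

(* [precompact A] means that the closure of [A], here for the weak topology,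
   is compact. *)
Definition weakly_compact_operator (E F : normedModType R) (S : E -> F) : Prop :=
  precompact (S @` [set x | `|x| <= 1] : set (weak F)).

(* Meaningful for bounded linear [S] only: [sup] is 0 on unbounded sets. *)
Definition opnorm (E F : normedModType R) (S : E -> F) : R :=
  sup [set `|S x| | x in [set x : E | `|x| <= 1]].

Definition bounded_operator (E F : normedModType R) (S : E -> F) : Prop :=
  exists M : R, forall x, `|S x| <= M * `|x|.

End operators.

Section atoms.
Context d (T : measurableType d) (R : realType).
Variable mu : {measure set T -> \bar R}.

Definition atom (A : set T) : Prop :=
  [/\ measurable A, (0 < mu A)%E &
      forall B, measurable B -> B `<=` A -> mu B = 0%E \/ mu (A `\` B) = 0%E].

Definition atomless : Prop := forall A, ~ atom A.

End atoms.

(* Main.v *)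
Require Import Defs.
From HB Require Import structures.
From mathcomp Require Import all_boot all_order all_algebra.
From mathcomp Require Import all_classical all_reals all_analysis.
From mathcomp Require Import measurable_realfun ring lra.

Set Implicit Arguments.
Unset Strict Implicit.
Unset Printing Implicit Defensive.
Import Order.TTheory GRing.Theory Num.Theory.
Import numFieldNormedType.Exports.
Local Open Scope classical_set_scope.
Local Open Scope ring_scope.

(** * Why the identity holds

    Only the inequality 1 + |T| <= |Id + T| needs an argument, and it is enough
    to find, for each f <> 0 and each c with c |f| < |T f|, a unit vector g such
    that |T g| >= c while T g has almost no mass on the support of g: then g and
    T g are nearly disjoint and their norms nearly add up ([norm_add_support]).

    Localisation.  The set function sending A to the integral of T (f 1_A)
    against the sign of T f, minus c times the mass of f on A, is a charge with
    positive total value.  Its Hahn decomposition gives a set P of positive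
    measure on all of whose subsets A it is nonnegative, so that every
    normalised restriction g of f to a subset of P has |T g| >= c
    ([Hahn_restr]).  As mu has no atoms, repeated halving produces inside P
    a decreasing sequence of non-null sets A_n with null intersection
    ([atomless_shrinking]).

    Uniform integrability.  T maps the unit ball into a relatively weakly
    compact set K, and the elements of K have uniformly small mass on A_n for
    n large ([uniform_integrability]); taking g supported by such an A_n
    finishes the proof.  This half of the Dunford-Pettis theorem is proved by
    a gliding hump.  If h_n in K keeps mass e on A_n, let x be the weak limit
    of h_n along a nonprincipal ultrafilter.  One chooses indices n_k and
    functions phi_k with values in [-1, 1], where phi_k differs from phi_(k-1)
    on A_(n_k) only, so that phi_k separates h_(n_k) by at least e from the
    value of phi_(k-1) at x, while all the earlier phi_j nearly agree at h_(n_k)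
    and at x.  The limit phi of the phi_k still separates every h_(n_k) from x
    by more than e/4.  However a weak limit x' of the subsequence h_(n_k) agrees
    with x on every phi_k, hence on phi, which is impossible. *)

(** * Ultrafilter limits and recursive choices *)

Lemma ultra_fmap (I X : Type) (U : set_system I) (h : I -> X) :
  UltraFilter U -> UltraFilter (h @ U).
Proof.
move=> UU; split; first exact: fmap_proper_filter.
move=> G PG sUG; apply/seteqP; split=> // A GA.
have [//|UA] := in_ultra_setVsetC (h @^-1` A) UU.
exfalso; apply: (@filter_not_empty _ G); rewrite -(setICr A).
by apply: filterI => //; exact: sUG.
Qed.

(** On a compact set every ultrafilter converges, so that a single point [x]
    serves all the functionals at once and no subsequence is extracted. *)
Lemma weak_ultralimit (R : realType) (E : normedModType R) (K : set (weak E))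
    (U : set_system nat) (h : nat -> E) :
  precompact K -> UltraFilter U -> (forall n, K (h n)) ->
  exists x : E, forall phi : dual E, sval phi (h n) @[n --> U] --> sval phi x.
Proof.
move=> [C KC [cC _]] UU hK.
move: cC; rewrite compact_ultra.
move=> /(_ ((h : nat -> weak E) @ U) (ultra_fmap _ UU)) [|x [Cx hx]].
  by apply: (@filterE _ U) => n; apply: KC; exact: hK.
exists x => phi; move: hx => /= /cvg_sup /(_ phi) hx.
exact: (cvg_comp _ _ hx (@initial_continuous _ _ (sval phi : E -> R^o) x)).
Qed.

(** Dependent choice where each new term may depend on all the previous ones. *)
Lemma history_choice (S : Type) (P : seq S -> S -> Prop) :
  (forall s, exists x, P s x) ->
  exists u : nat -> S, forall k, P (mkseq u k) (u k).
Proof.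
move=> /choice[F PF].
pose hist := fix hist k := if k is k'.+1 then rcons (hist k') (F (hist k')) else [::].
exists (fun k => F (hist k)) => k.
suff -> : mkseq (fun k => F (hist k)) k = hist k by exact: PF.
by elim: k => // k IH; rewrite mkseqS IH.
Qed.

(** * Integration against bounded functions *)

Section L1_basics.
Context d (Omega : measurableType d) (R : realType).
Variable mu : {measure set Omega -> \bar R}.
Local Notation L1 := (LspaceType1 mu).
Implicit Types (x y f g h : L1) (A B : set Omega).

Lemma L1_measurable x : measurable_fun setT (x : Omega -> R).
Proof. exact: (measurable_funPT (Lspace_repr x)). Qed.

Lemma L1_integrable x : mu.-integrable setT (EFin \o x).
Proof. by apply/Lfun1_integrable; exact: Lspace_Lfun. Qed.

Lemma L1_of_integrable (u : Omega -> R) : mu.-integrable setT (EFin \o u) ->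
  exists x : L1, \forall t \ae mu, x t = u t.
Proof.
move=> /Lfun1_integrable uL; exists (Lspace_class (Lfun_Sub (lexx 1%E) uL)).
by apply: filterS (Lspace_classE (Lfun_Sub (lexx 1%E) uL)) => t /= ->.
Qed.

Lemma Rintegral_ae_eq (u v : Omega -> R) :
  measurable_fun setT u -> measurable_fun setT v ->
  (\forall t \ae mu, u t = v t) -> \int[mu]_t u t = \int[mu]_t v t.
Proof.
move=> mu_ mv uv; congr fine; apply: ae_eq_integral => //.
- exact/measurable_EFinP.
- exact/measurable_EFinP.
- by apply: filterS uv => t /= ->.
Qed.

Lemma integrable_bounded_mul (phi : Omega -> R) (u : Omega -> R) :
  measurable_fun setT phi -> (forall t, `|phi t| <= 1) ->
  mu.-integrable setT (EFin \o u) ->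
  mu.-integrable setT (EFin \o (phi \* u)).
Proof.
move=> mphi phi1 iu.
apply: (le_integrable measurableT _ _ iu) => [|t _ /=].
  apply/measurable_EFinP; apply: measurable_funM => //.
  exact/measurable_EFinP/(measurable_int mu).
by rewrite lee_fin normrM ler_piMl.
Qed.

(** Multipliers represent the unit ball of L^oo as plain functions: modifying
    them on a set and taking pointwise limits requires values everywhere, not
    classes. *)
Record multiplier := Multiplier {
  mult_fun :> Omega -> R;
  mult_measurable : measurable_fun setT mult_fun;
  mult_le1 : forall t, `|mult_fun t| <= 1 }.

Implicit Types phi : multiplier.

Lemma mult_integrable phi x : mu.-integrable setT (EFin \o (fun t => phi t * x t)).
Proof.
apply: integrable_bounded_mul; [exact: mult_measurable|exact: mult_le1|].
exact: L1_integrable.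
Qed.

Definition pairing phi x : R^o := \int[mu]_t (phi t * x t).

Lemma integrable_measurable (u : Omega -> R) :
  mu.-integrable setT (EFin \o u) -> measurable_fun setT u.
Proof. by move=> /measurable_int/measurable_EFinP. Qed.

Lemma pairing_linear phi : linear (pairing phi).
Proof.
move=> a x y; rewrite /pairing.
have ix := mult_integrable phi x; have iy := mult_integrable phi y.
have iax : mu.-integrable setT (EFin \o (fun t => a * (phi t * x t))).
  exact: (integrableZl measurableT a ix).
transitivity (\int[mu]_t (a * (phi t * x t) + phi t * y t)).
  apply: Rintegral_ae_eq.
  - exact: integrable_measurable (mult_integrable _ _).
  - by apply: measurable_funD; exact: integrable_measurable.
  - near=> t; rewrite (near (LspaceDE (a *: x) y) t)//.
    by rewrite (near (LspaceZE a x) t)// mulrDr mulrCA.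
by rewrite RintegralD// RintegralZl.
Unshelve. all: by end_near. Qed.

HB.instance Definition _ phi :=
  GRing.isLinear.Build R L1 R^o *%R (pairing phi) (pairing_linear phi).

Lemma abs_integrable x : mu.-integrable setT (EFin \o (fun t => `|x t|)).
Proof. exact: (integrable_norm (L1_integrable x)). Qed.

Lemma pairing_le phi x : `|pairing phi x| <= `|x|.
Proof.
rewrite LspaceType1_norm.
apply: (le_trans (le_normr_Rintegral measurableT (mult_integrable phi x))).
apply: le_Rintegral => //.
- exact: (integrable_norm (mult_integrable phi x)).
- exact: abs_integrable.
- by move=> t _; rewrite normrM ler_piMl// mult_le1.
Qed.

Lemma pairing_continuous phi : continuous (pairing phi : L1 -> R^o).
Proof.
apply: bounded_linear_continuous; apply/linear_boundedP.
by near=> M => x; apply: (le_trans (pairing_le phi x)); rewrite ler_peMl.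
Unshelve. all: by end_near. Qed.

Definition pairing_dual phi : dual (LspaceType1 mu) :=
  exist (fun f : {linear L1 -> R^o} => continuous f)
    (pairing phi : {linear L1 -> R^o}) (@pairing_continuous phi).

End L1_basics.

(** * Mass on a set and restriction to a set *)

Section masses.
Context d (Omega : measurableType d) (R : realType).
Variable mu : {measure set Omega -> \bar R}.
Local Notation L1 := (LspaceType1 mu).
Implicit Types (x y f g h : L1) (A B : set Omega).

Definition mass A x : R := \int[mu]_(t in A) `|x t|.

Lemma massE A x : mass A x = \int[mu]_t (\1_A t * `|x t|).
Proof.
rewrite /mass Rintegral_mkcond; apply: eq_Rintegral => t _.
by rewrite patchE indicE; case: (t \in A); rewrite ?mul1r ?mul0r.
Qed.

Lemma indic_norm_le1 A (t : Omega) : `|\1_A t : R| <= 1.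
Proof. by rewrite indicE; case: (_ \in _); rewrite ?normr1 ?normr0. Qed.

Lemma mass_integrable A x : measurable A ->
  mu.-integrable setT (EFin \o (fun t => \1_A t * `|x t|)).
Proof.
move=> mA; apply: integrable_bounded_mul; last exact: abs_integrable.
- exact: measurable_indic.
- exact: indic_norm_le1.
Qed.

Lemma mass_ge0 A x : 0 <= mass A x.
Proof. exact: Rintegral_ge0. Qed.

Lemma mass_subset A B x : measurable A -> measurable B -> A `<=` B ->
  mass A x <= mass B x.
Proof.
move=> mA mB AB; rewrite !massE; apply: le_Rintegral => //.
- exact: mass_integrable.
- exact: mass_integrable.
- move=> t _; apply: ler_wpM2r => //; rewrite !indicE.
  case: (boolP (t \in A)) => [/set_mem /AB /mem_set -> //|_].
  by case: (t \in B).
Qed.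

(** The absolute continuity of the integral, in the only form used below. *)
Lemma mass_cvg0 (A_ : (set Omega)^nat) x : (forall n, measurable (A_ n)) ->
  nonincreasing_seq A_ -> mu (\bigcap_n A_ n) = 0%E ->
  mass (A_ n) x @[n --> \oo] --> 0.
Proof.
move=> mA dA A0.
have mI : measurable (\bigcap_n A_ n) by exact: bigcapT_measurable.
have [|||||_ _] := @dominated_convergence _ _ _ mu setT measurableT
  (fun n t => (\1_(A_ n) t * `|x t|)%:E) (cst 0%E) (EFin \o (fun t => `|x t|)).
- by move=> n; exact: (measurable_int mu (mass_integrable x (mA n))).
- exact: measurable_cst.
- exists (\bigcap_n A_ n); split => // t /= /not_implyP[_ nt] n _.
  apply: contrapT => nA; apply: nt; apply: (@cvg_near_cst _ _ 0%E).
  near=> m; rewrite indicE memNset ?mul0r// => Am.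
  have nm : (n <= m)%N by near: m; exact: nbhs_infty_ge.
  by apply: nA; have /subsetPset := dA _ _ nm; exact.
- exact: abs_integrable.
- apply: aeW => t n _ /=; rewrite lee_fin normrM normr_id.
  by rewrite ler_piMl// indic_norm_le1.
- rewrite integral0 => /fine_cvg; apply: cvg_trans; apply: near_eq_cvg.
  by apply: nearW => n /=; rewrite massE.
Unshelve. all: by end_near. Qed.

(** Being total in [A], [restr] can be turned into a set function, as charges
    require; it is only meaningful for measurable [A]. *)
Definition restr A x : L1 :=
  xget 0 [set y : L1 | \forall t \ae mu, y t = \1_A t * x t].

Lemma restrE A x : measurable A ->
  \forall t \ae mu, restr A x t = \1_A t * x t.
Proof.
move=> mA; rewrite /restr; case: xgetP => [y _ //|none].
exfalso.
have [|y yE] := @L1_of_integrable _ _ _ mu (fun t => \1_A t * x t).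
  apply: integrable_bounded_mul; last exact: L1_integrable.
  - exact: measurable_indic.
  - exact: indic_norm_le1.
exact: (none y).
Qed.

Lemma L1_ae_eq x y : (\forall t \ae mu, x t = y t) -> x = y.
Proof. by move=> xy; apply/LspaceP; apply: filterS xy => t ->. Qed.

Lemma restrT x : restr setT x = x.
Proof.
apply: L1_ae_eq; apply: filterS (restrE x measurableT) => t ->.
by rewrite indicT mul1r.
Qed.

Lemma norm_restr A x : measurable A -> `|restr A x| = mass A x.
Proof.
move=> mA; rewrite LspaceType1_norm massE; apply: Rintegral_ae_eq.
- exact: (integrable_measurable (abs_integrable _)).
- exact: (integrable_measurable (mass_integrable _ mA)).
- apply: filterS (restrE x mA) => t ->; rewrite normrM ger0_norm//.
Qed.

Lemma restrU A B x : measurable A -> measurable B -> [disjoint A & B] ->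
  restr (A `|` B) x = restr A x + restr B x.
Proof.
move=> mA mB dAB; apply: L1_ae_eq; near=> t.
rewrite (near (LspaceDE (restr A x) (restr B x)) t)//.
rewrite (near (restrE x mA) t)// (near (restrE x mB) t)//.
rewrite (near (restrE x (measurableU _ _ mA mB)) t)//.
rewrite -mulrDl; congr (_ * _); rewrite !indicE in_setU.
case: (boolP (t \in A)) => tA; case: (boolP (t \in B)) => tB //=;
  rewrite ?addr0 ?add0r//.
exfalso; move/disj_setPS : dAB => /(_ t); apply; split; exact: set_mem.
Unshelve. all: by end_near. Qed.

Lemma mass_negligible A x : measurable A -> mu A = 0%E -> mass A x = 0.
Proof.
move=> mA A0; rewrite /mass /Rintegral.
rewrite (_ : (\int[mu]_(t in A) `|x t|%:E)%E = 0%E)//.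
apply: (@integral_abs_eq0 _ _ _ mu A (EFin \o x)) => //.
by apply/measurable_EFinP; apply: measurable_funTS; exact: L1_measurable.
Qed.

Lemma mass_eq0 A x : measurable A -> (forall t, A t -> x t != 0) ->
  mass A x = 0 -> mu A = 0%E.
Proof.
move=> mA x0 m0.
have mx : measurable_fun A (EFin \o x).
  by apply/measurable_EFinP; apply: measurable_funTS; exact: L1_measurable.
have : (\int[mu]_(t in A) `|(EFin \o x) t| = 0)%E.
  rewrite -[LHS]fineK; first by rewrite -[fine _]/(mass A x) m0.
  apply: integrable_fin_num => //.
  exact: (integrableS measurableT mA _ (abs_integrable x)).
move/(ae_eq_integral_abs mu mA mx) => -[N [mN N0 AN]].
apply/eqP; rewrite -measure_le0 -N0; apply: le_measure; rewrite ?inE//.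
move=> t At; apply: AN => /= /(_ At) [xt0]; move: (x0 _ At).
by rewrite xt0 eqxx.
Qed.

End masses.

(** * Localisation: Hahn decomposition and halving *)

Section shrinking.
Context d (Omega : measurableType d) (R : realType).
Variable mu : {measure set Omega -> \bar R}.
Local Notation L1 := (LspaceType1 mu).
Implicit Types (x y f g h : L1) (A B : set Omega).

Lemma massD A B x : measurable A -> measurable B -> B `<=` A ->
  mass A x = mass B x + mass (A `\` B) x.
Proof.
move=> mA mB BA; rewrite /mass -[in LHS](setDUK BA); apply: Rintegral_setU => //.
- exact: measurableD.
- rewrite (setDUK BA).
  exact: (integrableS measurableT mA _ (abs_integrable x)).
- by apply/disj_setPS => t [Bt [_ /(_ Bt)]].
Qed.

Lemma restr0 f : restr set0 f = 0.
Proof.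
apply/eqP; rewrite -normr_eq0 norm_restr//; apply/eqP.
exact: Rintegral_set0.
Qed.

(** The set function [A |-> L (restr A f)] is a charge: its sigma-additivity
    comes from [mass_cvg0] and the boundedness of [L].  As its total value is
    positive, so is its value on the positive part of a Hahn decomposition. *)
Lemma Hahn_restr (L : L1 -> R) (M : R) f :
  {morph L : x y / x + y} -> (forall x, `|L x| <= M * `|x|) -> 0 < L f ->
  exists P, [/\ measurable P, 0 < L (restr P f) &
    forall B, measurable B -> B `<=` P -> 0 <= L (restr B f)].
Proof.
move=> LD LM Lf.
have L0 : L 0 = 0 by apply: (addrI (L 0)); rewrite -LD !addr0.
pose k A : \bar R := (L (restr A f))%:E.
have k0 : k set0 = 0%E by rewrite /k restr0 L0.
have kfin A : measurable A -> k A \is a fin_num by [].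
have ksigma : semi_sigma_additive k.
  move=> F mF tF mUF.
  pose G n := \big[setU/set0]_(i < n) F i.
  have mG n : measurable (G n) by exact: bigsetU_measurable.
  have GS n : G n.+1 = G n `|` F n by rewrite /G big_ord_recr.
  have GF n : [disjoint G n & F n].
    apply/disj_setPS => t []; rewrite /G -bigcup_mkord => -[i /= ni Fit] Fnt.
    by move: ni; rewrite (tF i n)// ?ltnn//; exists t.
  have sumG n : (\sum_(0 <= i < n) k (F i))%E = k (G n).
    elim: n => [|n IH]; first by rewrite big_geq// /G big_ord0 k0.
    by rewrite big_nat_recr//= IH GS /k restrU// LD EFinD.
  have GU n : G n `<=` \bigcup_n F n.
    by rewrite /G -bigcup_mkord => t [i _ Fit]; exists i.
  pose A n := (\bigcup_n F n) `\` G n.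
  have mA n : measurable (A n) by exact: measurableD.
  have A0 : mass (A n) f @[n --> \oo] --> 0.
    apply: mass_cvg0 => //.
    - move=> m n mn; apply/subsetPset; apply: setDS.
      rewrite /G -!bigcup_mkord => t [i /= im Fit].
      by exists i => //=; exact: leq_trans mn.
    - rewrite (_ : \bigcap_n A n = set0) ?measure0//; apply/seteqP; split=> // t At.
      have [[i _ Fit] _] := At 0%N I.
      have [_] := At i.+1 I; apply; rewrite GS; by right.
  rewrite (_ : (fun n => _) = fun n => k (G n)); last exact/funext.
  apply: cvg_EFin; first exact: nearW.
  apply/cvgrPdist_le => e e0.
  have [N _ HN] : \forall n \near \oo, `|M| * mass (A n) f <= e.
    have : `|M| * mass (A n) f @[n --> \oo] --> `|M| * 0 by apply: cvgM => //; exact: cvg_cst.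
    rewrite mulr0 => /cvgr_le; apply; exact: e0.
  exists N => // n /HN; apply: le_trans.
  have dGA : [disjoint G n & A n].
    by apply/disj_setPS => t [Gt [_ /(_ Gt)]].
  have -> : restr (\bigcup_n F n) f = restr (G n) f + restr (A n) f.
    by rewrite -restrU// /A setDUK.
  rewrite LD addrAC subrr add0r; apply: (le_trans (LM _)).
  by rewrite norm_restr//; apply: ler_wpM2r; [exact: mass_ge0|exact: ler_norm].
pose nu : {charge set Omega -> \bar R} := HB.pack k (isCharge.Build _ _ _ k k0 kfin ksigma).
have [P [N [[mP posP] [mN negN] PN PN0]]] := Hahn_decomposition nu.
exists P; split => //.
have : 0 < L (restr (P `|` N) f) by rewrite PN restrT.
rewrite restrU//; last by apply/eqP.
rewrite LD => /lt_le_trans; apply; rewrite gerDl.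
by have := negN N mN (@subset_refl _ N); rewrite lee_fin.
Qed.

(** A non-null set splits into two non-null parts, and keeping the part where
    [f] has less mass divides the mass of [f] by at least two.  Halving the mass
    of [f] rather than [mu] makes this work for sets of infinite measure; the
    intersection carries no mass of [f], hence is null as [f] does not vanish. *)
Lemma atomless_shrinking f (P : set Omega) : atomless mu -> measurable P ->
  (0 < mu P)%E -> (forall t, P t -> f t != 0) ->
  exists A_ : (set Omega)^nat, [/\ forall n, measurable (A_ n),
    nonincreasing_seq A_, forall n, A_ n `<=` P, forall n, (0 < mu (A_ n))%E &
    mu (\bigcap_n A_ n) = 0%E].
Proof.
move=> noatom mP P0 fP.
pose S := {A | [/\ measurable A, A `<=` P & (0 < mu A)%E]}.
have half (A : S) : {B : S | projT1 B `<=` projT1 A /\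
    mass (projT1 B) f <= mass (projT1 A) f / 2}.
  apply: cid; case: A => A [mA AP A0] /=.
  have [B [mB BA B0 AB0]] : exists B, [/\ measurable B, B `<=` A, (0 < mu B)%E &
      (0 < mu (A `\` B))%E].
    apply: contrapT => nB; apply: (noatom A); split => // B mB BA.
    apply: contrapT => /not_orP[B0 AB0]; apply: nB; exists B; split => //.
      by rewrite lt0e measure_ge0 andbT; exact/eqP.
    by rewrite lt0e measure_ge0 andbT; exact/eqP.
  have mAB : measurable (A `\` B) by exact: measurableD.
  have mE := massD f mA mB BA.
  have [le|lt] := leP (mass B f) (mass (A `\` B) f).
    unshelve eexists (exist _ B _) => /=; first by split=> //; exact: subset_trans AP.
    by split => //; rewrite mE; lra.
  unshelve eexists (exist _ (A `\` B) _) => /=.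
    by split=> //; apply: subset_trans AP; exact: subDsetl.
  by split; [exact: subDsetl|rewrite mE; lra].
have [u [_ uS]] := dependent_choice half (exist _ P (And3 mP (@subset_refl _ P) P0)).
have mu_ n : measurable (projT1 (u n)) by case: (u n) => ? [].
have mI : measurable (\bigcap_n projT1 (u n)) by exact: bigcapT_measurable.
have uP n : projT1 (u n) `<=` P by case: (u n) => ? [].
exists (fun n => projT1 (u n)); split => //.
- by apply/nonincreasing_seqP => n; apply/subsetPset; case: (uS n).
- by move=> n; case: (u n) => ? [].
apply: (mass_eq0 (x := f)) => //; first by move=> t /(_ 0%N I); move/uP/fP.
have geom n : mass (projT1 (u n)) f <= geometric (mass (projT1 (u 0%N)) f) 2^-1 n.
  elim: n => [|n IH]; first by rewrite /geometric/= expr0 mulr1.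
  apply: (le_trans (proj2 (uS n))); rewrite /geometric/= exprSr mulrA.
  by rewrite ler_pM2r// invr_gt0.
apply/eqP; rewrite eq_le mass_ge0 andbT.
have g0 : geometric (mass (projT1 (u 0%N)) f) 2^-1 n @[n --> \oo] --> (0 : R).
  by apply: cvg_geometric; rewrite ger0_norm ?invr_ge0// invf_lt1// ltr1n.
rewrite -(cvg_lim (@Rhausdorff R) g0); apply: limr_ge; first exact: (cvgP _ g0).
apply: nearW => n; apply: le_trans (geom n); apply: mass_subset => //.
exact: bigcap_inf.
Qed.

End shrinking.

(** * Tools for the gliding hump *)

Section gliding_hump.
Context d (Omega : measurableType d) (R : realType).
Variable mu : {measure set Omega -> \bar R}.
Local Notation L1 := (LspaceType1 mu).
Implicit Types (x y f g h : L1) (A B : set Omega) (phi : multiplier Omega R).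

Definition zero_mult : multiplier Omega R.
Proof.
exists (fun=> 0); first exact: measurable_cst.
by move=> t; rewrite normr0.
Defined.

Definition sgn_mult x : multiplier Omega R.
Proof.
exists (fun t => if 0 <= x t then 1 else -1 : R).
  apply: measurable_fun_ifT => //; apply: measurable_fun_ler => //.
  exact: L1_measurable.
by move=> t; case: (0 <= x t); rewrite ?normrN normr1.
Defined.

Definition opp_mult phi : multiplier Omega R.
Proof.
exists (fun t => - phi t).
  by apply: measurableT_comp => //; exact: mult_measurable.
by move=> t; rewrite normrN mult_le1.
Defined.

Definition patch_mult phi A (mA : measurable A) phi' : multiplier Omega R.
Proof.
exists (patch phi A phi').
  apply: measurable_fun_ifT; try exact: mult_measurable.
  apply: (measurable_fun_bool true); rewrite setTI.
  rewrite (_ : _ @^-1` _ = A)//; apply/seteqP; split => t /=.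
    by move=> /set_mem.
  by move=> /mem_set.
by move=> t; rewrite /patch; case: ifP; rewrite mult_le1.
Defined.

Lemma pairing_sgn x : pairing (sgn_mult x) x = `|x|.
Proof.
rewrite LspaceType1_norm; apply: eq_Rintegral => t _ /=.
by case: ifPn => [x0|]; [rewrite mul1r ger0_norm|rewrite -ltNge mulN1r => /ltr0_norm ->].
Qed.

Lemma pairing_off phi phi' A x : measurable A ->
  (forall t, ~ A t -> phi t = phi' t) ->
  `|pairing phi x - pairing phi' x| <= 2 * mass A x.
Proof.
move=> mA pp.
have ip := mult_integrable phi x; have ip' := mult_integrable phi' x.
rewrite /pairing -RintegralB//.
have iB : mu.-integrable setT (EFin \o (fun t => phi t * x t - phi' t * x t)).
  exact: (integrableB measurableT ip ip').
apply: (le_trans (le_normr_Rintegral measurableT iB)).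
rewrite massE -RintegralZl//; last exact: mass_integrable.
apply: le_Rintegral => //.
- exact: (integrable_norm iB).
- exact: (integrableZl measurableT 2 (mass_integrable x mA)).
move=> t _; rewrite indicE; case: (boolP (t \in A)) => tA.
  rewrite mul1r -mulrBl normrM ler_wpM2r//.
  by rewrite (le_trans (ler_normB _ _))// -[2]/(1 + 1) lerD// mult_le1.
by rewrite pp ?subrr ?normr0 ?mul0r ?mulr0//; move/negP: tA => + /mem_set.
Qed.

(** Putting either the sign of [x] or its opposite on [A] gives two multipliers
    whose values at [x] differ by [2 * mass A x], so that at least one of them
    is at distance at least [mass A x] from [r]. *)
Lemma hump_step phi A x (r : R) : measurable A ->
  exists phi', (forall t, ~ A t -> phi' t = phi t) /\
    mass A x <= `|pairing phi' x - r|.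
Proof.
move=> mA.
pose p := patch_mult phi mA (sgn_mult x).
pose q := patch_mult phi mA (opp_mult (sgn_mult x)).
have pq : pairing p x - pairing q x = 2 * mass A x.
  rewrite /pairing -RintegralB//; try exact: mult_integrable.
  rewrite massE -RintegralZl//; last exact: mass_integrable.
  apply: eq_Rintegral => t _ /=; rewrite !/patch indicE /=.
  case: (t \in A); last by rewrite subrr mul0r mulr0.
  rewrite mul1r mulNr opprK; have [x0|x0] := leP 0 (x t).
    by rewrite ger0_norm//; ring.
  by rewrite ltr0_norm//; ring.
have off s t : ~ A t -> patch_mult phi mA s t = phi t.
  by move=> At; rewrite /= /patch memNset.
have [le|gt] := leP (mass A x) `|pairing p x - r|; first by exists p; split => //; exact: off.
exists q; split; first exact: off.
have := ler_normD (pairing p x - r) (- (pairing q x - r)).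
rewrite normrN (_ : pairing p x - r - (pairing q x - r) = 2 * mass A x); last first.
  by rewrite -pq; ring.
rewrite ger0_norm ?mulr_ge0 ?mass_ge0// => H; lra.
Qed.

(** Outside the intersection of the [B k] the sequence is eventually constant;
    on the intersection it need not converge and the limit is set to zero. *)
Lemma multiplier_limit (phi_ : nat -> multiplier Omega R) (B : (set Omega)^nat) :
  (forall k, measurable (B k)) ->
  (forall j k t, (k <= j)%N -> ~ B k t -> phi_ j t = phi_ k t) ->
  exists phi, forall k t, ~ B k t -> phi t = phi_ k t.
Proof.
move=> mB pB.
pose J := \bigcap_k B k.
have mJ : measurable J by exact: bigcapT_measurable.
pose psi k := patch_mult (phi_ k) mJ zero_mult.
have psi_off j k t : (k <= j)%N -> ~ B k t -> psi j t = phi_ k t.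
  move=> kj Bt; rewrite /= /patch memNset; first exact: pB.
  by move=> /(_ k I).
have psi_cvg t : exists v : R, psi k t @[k --> \oo] --> v.
  have [Jt|/existsNP[k /not_implyP[_ Bt]]] := pselect (J t).
    exists 0; rewrite (_ : (fun k => psi k t) = cst 0); first exact: cvg_cst.
    by apply/funext => k; rewrite /= /patch mem_set.
  exists (phi_ k t); apply: cvg_near_cst; exists k => // j kj.
  exact: psi_off.
have [v psiv] := choice psi_cvg.
unshelve eexists (@Multiplier _ _ _ v _ _).
- apply: (measurable_fun_cvg (h := fun k => psi k)) => //.
    by move=> k; exact: mult_measurable.
- move=> t; have : `|psi k t| @[k --> \oo] --> `|v t| by exact: cvg_norm.
  move=> /[dup] /cvg_lim <- //.
  by move=> cv; apply: limr_le; [exact: (cvgP _ cv)|apply: nearW => k; exact: mult_le1].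
- move=> k t Bt /=.
  apply: (@cvg_unique _ (@Rhausdorff R) _ _ _ _ (psiv t)).
  by apply: cvg_near_cst; exists k => // j kj; exact: psi_off.
Qed.

End gliding_hump.

(** * Uniform integrability of weakly compact sets *)

Section uniform_integrability.
Context d (Omega : measurableType d) (R : realType).
Variable mu : {measure set Omega -> \bar R}.
Local Notation L1 := (LspaceType1 mu).
Implicit Types (x y f g h : L1) (A B : set Omega) (phi : multiplier Omega R).

(** One direction of the Dunford-Pettis theorem, by a gliding hump.  The sets
    are nested, so that a multiplier obtained at stage [k] is never modified
    later outside [A (n_ k.+1)]: a single small mass controls all the later
    modifications, and no series of errors has to be summed. *)
Lemma uniform_integrability (K : set (weak L1)) (A : (set Omega)^nat) (e : R) :
  precompact K -> (forall n, measurable (A n)) -> nonincreasing_seq A ->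
  mu (\bigcap_n A n) = 0%E -> 0 < e ->
  exists n, forall h : L1, K h -> mass (A n) h < e.
Proof.
move=> cK mA dA A0 e0; apply: contrapT => /forallNP noN.
have /choice[h hP] : forall n, exists h : L1, K h /\ e <= mass (A n) h.
  move=> n; apply: contrapT => nh; apply: (noN n) => h Kh.
  by rewrite ltNge; apply/negP => eh; apply: nh; exists h.
have hK n : K (h n) by case: (hP n).
have he n : e <= mass (A n) (h n) by case: (hP n).
have Asub m n : (m <= n)%N -> A n `<=` A m.
  by move=> mn; apply/subsetPset; exact: dA.
have Amass x r : 0 < r -> \forall n \near \oo, mass (A n) x <= r.
  by move=> r0; have /cvgr_le := mass_cvg0 x mA dA A0; apply.
have [U [UU ooU]] := ultraFilterLemma (@eventually_filter).
have PU : ProperFilter U := ultra_proper.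
have [x hx] := weak_ultralimit cK UU hK.
have {}hx phi : pairing phi (h n) @[n --> U] --> pairing phi x.
  exact: (hx (pairing_dual mu phi)).
pose S := (nat * multiplier Omega R)%type.
pose s0 : S := (0%N, zero_mult Omega R).
(* [s] lists the stages already built.  The new index makes the new set
   negligible for [x] and for all the earlier [h n], and puts [h n] close to [x]
   for all the earlier multipliers.  For the first stage, where [s] is empty,
   the current multiplier is the default value [s0.2], that is zero. *)
pose P (s : seq S) (p : S) := [/\
  forall i, (i < size s)%N -> [/\ ((nth s0 s i).1 < p.1)%N,
     mass (A p.1) (h (nth s0 s i).1) <= e / 8 &
     `|pairing (nth s0 s i).2 x - pairing (nth s0 s i).2 (h p.1)| <= (size s).+1%:R^-1],
  mass (A p.1) x <= e / 8,
  forall t, ~ A p.1 t -> p.2 t = (nth s0 s (size s).-1).2 t &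
  e <= `|pairing p.2 (h p.1) - pairing (nth s0 s (size s).-1).2 x|].
have e80 : 0 < e / 8 by rewrite divr_gt0.
have [s|u uP] := @history_choice S P.
  have Hi : \forall n \near U, forall i : 'I_(size s), [/\ ((nth s0 s i).1 < n)%N,
     mass (A n) (h (nth s0 s i).1) <= e / 8 &
     `|pairing (nth s0 s i).2 x - pairing (nth s0 s i).2 (h n)| <= (size s).+1%:R^-1].
    apply: filter_forall => i.
    have H1 : \forall n \near U, ((nth s0 s i).1 < n)%N.
      by apply: ooU; exact: nbhs_infty_gt.
    have H2 : \forall n \near U, mass (A n) (h (nth s0 s i).1) <= e / 8.
      by apply: ooU; exact: Amass.
    have H3 : \forall n \near U,
        `|pairing (nth s0 s i).2 x - pairing (nth s0 s i).2 (h n)| <= (size s).+1%:R^-1.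
      have /cvgrPdist_le := hx (nth s0 s i).2; apply.
      by rewrite invr_gt0 ltr0n.
    by near=> n; split; near: n.
  have Hx : \forall n \near U, mass (A n) x <= e / 8 by apply: ooU; exact: Amass.
  have [n [Hin Hxn]] := filter_ex (filterI Hi Hx).
  have [phi [phi_off phi_far]] := hump_step (nth s0 s (size s).-1).2 (h n)
    (pairing (nth s0 s (size s).-1).2 x) (mA n).
  exists (n, phi); split => //=; last exact: le_trans phi_far.
  by move=> i si; exact: (Hin (Ordinal si)).
pose n_ k := (u k).1; pose phi_ k := (u k).2.
have past i k : (i < k)%N -> [/\ (n_ i < n_ k)%N, mass (A (n_ k)) (h (n_ i)) <= e / 8 &
    `|pairing (phi_ i) x - pairing (phi_ i) (h (n_ k))| <= k.+1%:R^-1].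
  by move=> ik; have [+ _ _ _] := uP k; move=> /(_ i); rewrite size_mkseq nth_mkseq//; exact.
have xA k : mass (A (n_ k)) x <= e / 8 by have [] := uP k.
have prev k : nth s0 (mkseq u k.+1) (size (mkseq u k.+1)).-1 = u k.
  by rewrite size_mkseq nth_mkseq.
have off k t : ~ A (n_ k.+1) t -> phi_ k.+1 t = phi_ k t.
  by have [_ _ + _] := uP k.+1; rewrite prev; exact.
have far k : e <= `|pairing (phi_ k.+1) (h (n_ k.+1)) - pairing (phi_ k) x|.
  by have [_ _ _] := uP k.+1; rewrite prev.
have n_le i k : (i <= k)%N -> (n_ i <= n_ k)%N.
  by rewrite leq_eqVlt => /predU1P[->//|/past[/ltnW]].
have k_le k : (k <= n_ k)%N.
  by elim: k => // k IH; have [/(leq_ltn_trans IH)] := past k k.+1 (ltnSn k).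
have [phi phiE] : exists phi, forall k t, ~ A (n_ k.+1) t -> phi t = phi_ k t.
  apply: multiplier_limit => // j k t kj At.
  elim: j kj => [|j IH]; first by rewrite leqn0 => /eqP ->.
  rewrite leq_eqVlt => /predU1P[-> //|kj].
  rewrite off ?IH// => /Asub At'; apply: At; apply: At'; exact: n_le.
have phi_close k y : `|pairing phi y - pairing (phi_ k) y| <= 2 * mass (A (n_ k.+1)) y.
  by apply: pairing_off => // t; exact: phiE.
have phi_cvg y : pairing (phi_ k) y @[k --> \oo] --> pairing phi y.
  apply/cvgrPdist_le => r r0.
  have [N _ HN] := Amass y (r / 2) (divr_gt0 r0 (ltr0Sn _ 1)).
  exists N => // k /= Nk; apply: (le_trans (phi_close k y)).
  have : mass (A (n_ k.+1)) y <= mass (A k) y.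
    apply: mass_subset => //; apply: Asub; apply: leq_trans (k_le k.+1); exact: leqnSn.
  by move=> /le_trans/(_ (HN _ Nk)) => H; lra.
(* The subsequence may have another limit along [U], but the two limits cannot
   be told apart by the multipliers built above, nor by their limit. *)
have [x' hx'] := weak_ultralimit cK UU (fun k => hK (n_ k)).
have {}hx' psi : pairing psi (h (n_ k)) @[k --> U] --> pairing psi x'.
  exact: (hx' (pairing_dual mu psi)).
have xx' i : pairing (phi_ i) x' = pairing (phi_ i) x.
  apply: (@cvg_unique _ (@Rhausdorff R) _ _ _ _ (hx' (phi_ i))).
  apply/cvgrPdist_le => r r0; apply: ooU.
  have [N _ HN] : \forall k \near \oo, (k.+1%:R^-1 : R) <= r.
    have /cvgr_le := @cvg_harmonic R; exact.
  exists (maxn N i.+1) => // k /=; rewrite geq_max => /andP[Nk ik].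
  by have [_ _ /le_trans] := past i k ik; apply; exact: HN.
have phixx' : pairing phi x' = pairing phi x.
  have := phi_cvg x; rewrite -(eq_cvg _ _ xx').
  exact: (@cvg_unique _ (@Rhausdorff R) _ _ _ _ (phi_cvg x')).
have : \forall k \near U, `|pairing phi x - pairing phi (h (n_ k))| <= e / 4.
  by have /cvgrPdist_le := hx' phi; rewrite phixx'; apply; rewrite divr_gt0.
have : \forall k \near U, (0 < k)%N by apply: ooU; exact: nbhs_infty_gt.
move=> /filterI H /H{H} /filter_ex [[|k] [//= _ close]].
(* At [h (n_ k.+1)] and at [x], [phi] is within [2 * (e / 8)] of [phi_ k.+1] and
   [phi_ k]; together with the distance [e / 4] above this stays below [e]. *)
have d1 := phi_close k.+1 (h (n_ k.+1)).
have d2 := phi_close k x.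
have [_ m1 _] := past k.+1 k.+2 (ltnSn _).
have m2 := xA k.+1.
have := far k.
rewrite (_ : _ - _ = - (pairing phi (h (n_ k.+1)) - pairing (phi_ k.+1) (h (n_ k.+1)))
  + (pairing phi x - pairing (phi_ k) x)
  - (pairing phi x - pairing phi (h (n_ k.+1)))); last by ring.
move=> /le_trans/(_ (ler_normB _ _)); rewrite leNgt => /negP; apply.
apply: (@le_lt_trans _ _ (2 * (e / 8) + 2 * (e / 8) + e / 4)); last by lra.
apply: lerD => //; apply: le_trans (ler_normD _ _) _; rewrite normrN.
by apply: lerD; [apply: le_trans d1 _|apply: le_trans d2 _]; rewrite ler_pM2l.
Unshelve. all: by end_near. Qed.

End uniform_integrability.

(** * Nearly disjoint images and the operator norm *)

Section Daugavet.
Context d (Omega : measurableType d) (R : realType).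
Variable mu : {measure set Omega -> \bar R}.
Local Notation L1 := (LspaceType1 mu).
Implicit Types (x y f g h : L1) (A B : set Omega).

(** Outside [A] the norms add; on [A] the bound [`|y + h| >= `|y| - `|h|] costs
    the mass of [h] there twice. *)
Lemma norm_add_support y h A : measurable A ->
  (\forall t \ae mu, y t = \1_A t * y t) ->
  `|y| + `|h| - 2 * mass A h <= `|y + h|.
Proof.
move=> mA yA; rewrite lerBlDr.
have iy : mu.-integrable setT (EFin \o (fun t => \1_A t * y t)).
  apply: integrable_bounded_mul; last exact: L1_integrable.
  - exact: measurable_indic.
  - exact: indic_norm_le1.
have iyh : mu.-integrable setT (EFin \o (fun t => \1_A t * y t + h t)).
  exact: (integrableD measurableT iy (L1_integrable h)).
have -> : `|y| = \int[mu]_t `|\1_A t * y t|.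
  rewrite LspaceType1_norm; apply: Rintegral_ae_eq.
  - exact: (integrable_measurable (abs_integrable _)).
  - exact: (integrable_measurable (integrable_norm iy)).
  - by apply: filterS yA => t {1}->.
have -> : `|y + h| = \int[mu]_t `|\1_A t * y t + h t|.
  rewrite LspaceType1_norm; apply: Rintegral_ae_eq.
  - exact: (integrable_measurable (abs_integrable _)).
  - exact: (integrable_measurable (integrable_norm iyh)).
  - near=> t; rewrite (near (LspaceDE y h) t)//.
    by congr (`| _ + _ |); near: t.
have iA := mass_integrable h mA.
have i2A : mu.-integrable setT (EFin \o (fun t => 2 * (\1_A t * `|h t|))).
  exact: (integrableZl measurableT 2 iA).
rewrite (LspaceType1_norm h) massE -RintegralZl//.
rewrite -RintegralD//; [|exact: (integrable_norm iy)|exact: abs_integrable].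
rewrite -RintegralD//; last exact: (integrable_norm iyh).
apply: le_Rintegral => //.
- exact: (integrableD measurableT (integrable_norm iy) (abs_integrable h)).
- exact: (integrableD measurableT (integrable_norm iyh) i2A).
move=> t _; rewrite indicE; case: (t \in A).
  rewrite !mul1r; have := ler_normB (y t + h t) (h t).
  by rewrite addrK => H; lra.
by rewrite !mul0r mulr0 normr0 add0r addr0 add0r.
Unshelve. all: by end_near. Qed.

Lemma pairing_sgn_restr f A : measurable A ->
  pairing (sgn_mult f) (restr A f) = mass A f.
Proof.
move=> mA; rewrite massE; apply: Rintegral_ae_eq.
- exact: (integrable_measurable (mult_integrable _ _)).
- exact: (integrable_measurable (mass_integrable _ mA)).
- apply: filterS (restrE f mA) => t ->; rewrite mulrCA; congr (_ * _).
  by rewrite /=; have [x0|x0] := leP 0 (f t);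
    [rewrite mul1r ger0_norm|rewrite mulN1r ltr0_norm].
Qed.

Lemma mass_gt0 A f : measurable A -> (forall t, A t -> f t != 0) ->
  (0 < mu A)%E -> 0 < mass A f.
Proof.
move=> mA fA; rewrite !lt0r mass_ge0 andbT; apply: contraTneq => /(mass_eq0 mA fA) ->.
by rewrite ltxx.
Qed.

Lemma mass_gt0_support f (P : set Omega) : measurable P -> 0 < mass P f ->
  exists Q, [/\ measurable Q, Q `<=` P, (0 < mu Q)%E & forall t, Q t -> f t != 0].
Proof.
move=> mP P0; pose Z := f @^-1` [set 0].
have mZ : measurable Z by rewrite -[Z]setTI; exact: L1_measurable.
exists (P `\` Z); split => //.
- exact: measurableD.
- rewrite lt0e measure_ge0 andbT; apply: contraTneq P0 => PZ0.
  have mPZ : measurable (P `\` Z) by exact: measurableD.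
  rewrite (massD f mP mPZ) ?(mass_negligible f mPZ PZ0); last exact: subDsetl.
  rewrite add0r -leNgt setDD /mass -[leRHS](mul0r (fine (mu (P `&` Z)))).
  rewrite -Rintegral_cst; last exact: measurableI.
  rewrite le_eqVlt; apply/orP; left; apply/eqP; apply: eq_Rintegral.
  by move=> t /set_mem [_ /= ->]; rewrite normr0.
- by move=> t [_ ft]; apply/eqP.
Qed.

(** The number [c] bounds [T] from below on normalised restrictions of [f] to
    subsets of the Hahn set [P]; the support of [g] is then taken small enough
    for the whole image of the unit ball to have mass less than [e / 2] on it. *)
Lemma nearly_disjoint_image (T : {linear L1 -> L1}) f (c e : R) :
  atomless mu -> bounded_operator T -> weakly_compact_operator T ->
  c * `|f| < `|T f| -> 0 < e ->
  exists g, `|g| = 1 /\ 1 + c - e <= `|g + T g|.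
Proof.
move=> noatom [M TM] wT cf e0.
pose L x : R := pairing (sgn_mult (T f)) (T x) - c * pairing (sgn_mult f) x.
have LD : {morph L : x y / x + y}.
  by move=> x y; rewrite /L !linearD/= mulrDr; ring.
have LM x : `|L x| <= (M + `|c|) * `|x|.
  rewrite mulrDl (le_trans (ler_normB _ _))// normrM lerD//.
    exact: le_trans (pairing_le _ _) (TM x).
  by apply: ler_wpM2l => //; exact: pairing_le.
have Lf : 0 < L f by rewrite /L !pairing_sgn subr_gt0.
have [P [mP LP posP]] := Hahn_restr LD LM Lf.
have [|Q [mQ QP Q0 fQ]] := mass_gt0_support mP (f := f).
  rewrite lt0r mass_ge0 andbT -norm_restr// normr_eq0; apply: contraTneq LP => ->.
  have -> : L 0 = 0 by apply: (addrI (L 0)); rewrite -LD !addr0.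
  by rewrite ltxx.
have [A [mA dA AQ A0 Acap]] := atomless_shrinking noatom mQ Q0 fQ.
have [n An] := uniform_integrability wT mA dA Acap (divr_gt0 e0 (ltr0Sn R 1)).
have m0 : 0 < mass (A n) f by apply: mass_gt0 => // t /AQ/fQ.
pose g := (mass (A n) f)^-1 *: restr (A n) f.
have g1 : `|g| = 1.
  by rewrite normrZ norm_restr// gtr0_norm ?invr_gt0// mulVf// gt_eqF.
have Tg : c <= `|T g|.
  apply: le_trans (pairing_le (sgn_mult (T f)) _); apply: le_trans (ler_norm _).
  rewrite /g !linearZ/=.
  rewrite -(ler_pM2l m0) mulrA divff ?gt_eqF// mul1r mulrC.
  have := posP _ (mA n) (subset_trans (AQ n) QP).
  by rewrite /L pairing_sgn_restr// subr_ge0.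
exists g; split => //.
have hT : mass (A n) (T g) < e / 2.
  by apply: An; exists g => //=; rewrite g1.
have gA : \forall t \ae mu, g t = \1_(A n) t * g t.
  near=> t; rewrite (near (LspaceZE (mass (A n) f)^-1 (restr (A n) f)) t)//.
  rewrite (near (restrE f (mA n)) t)// [RHS]mulrCA; congr (_ * _).
  by rewrite mulrA indicE -natrM mulnb andbb.
have := norm_add_support (T g) (mA n) gA.
by rewrite g1 => H; lra.
Unshelve. all: by end_near. Qed.

End Daugavet.

Lemma opnorm_has_sup (R : realType) (E F : normedModType R) (S : E -> F) (M : R) :
  (forall x, `|S x| <= M * `|x|) ->
  has_sup [set `|S x| | x in [set x : E | `|x| <= 1]].
Proof.
move=> SM; split; first by exists `|S 0|, 0 => //=; rewrite normr0.
exists `|M| => _ [y /= y1 <-]; apply: (le_trans (SM y)).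
apply: (@le_trans _ _ (`|M| * `|y|)); first by rewrite ler_wpM2r// ler_norm.
by rewrite ler_piMr.
Qed.

Lemma opnorm_ge (R : realType) (E F : normedModType R) (S : E -> F) (M : R) x :
  (forall x, `|S x| <= M * `|x|) -> `|x| <= 1 -> `|S x| <= opnorm S.
Proof.
by move=> SM x1; apply: (ub_le_sup (proj2 (opnorm_has_sup SM))); exists x.
Qed.

Theorem corollary6 (R : realType) (d : measure_display)
    (Omega : measurableType d) (mu : {measure set Omega -> \bar R})
    (mu_atomless : atomless mu)
    (L1_neq0 : exists f : LspaceType1 mu, f != 0)
    (T : {linear LspaceType1 mu -> LspaceType1 mu})
    (T_bounded : bounded_operator T)
    (T_weakly_compact : weakly_compact_operator T) :
  opnorm (idfun \+ T) = 1 + opnorm T.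
Proof.
have [M TM] := T_bounded.
have IM x : `|(idfun \+ T) x| <= (1 + M) * `|x|.
  by rewrite /= mulrDl mul1r (le_trans (ler_normD _ _))// lerD2l.
apply/eqP; rewrite eq_le; apply/andP; split.
  apply: ge_sup; first by case: (opnorm_has_sup IM).
  move=> _ [x /= x1 <-]; apply: (le_trans (ler_normD _ _)); apply: lerD => //.
  exact: (opnorm_ge TM).
apply/ler_addgt0Pr => e e0; rewrite -lerBlDr.
have e20 : 0 < e / 2 by rewrite divr_gt0.
have [f cf] : exists f, (opnorm T - e / 2) * `|f| < `|T f|.
  (* In the first case [sup_adherent] could return [f = 0], for which the strict
     inequality fails. *)
  have [neg|nneg] := ltP (opnorm T - e / 2) 0.
    have [f0 f0N0] := L1_neq0; exists f0.
    by apply: (@lt_le_trans _ _ 0) => //; rewrite nmulr_rlt0// normr_gt0.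
  have [_ [f f1 <-] lf] := sup_adherent e20 (opnorm_has_sup TM).
  by exists f; apply: le_lt_trans lf; rewrite ler_piMr.
have [g [g1 gT]] := nearly_disjoint_image mu_atomless T_bounded T_weakly_compact cf e20.
have := opnorm_ge IM (x := g); rewrite g1 lexx => /(_ isT) H.
apply: le_trans H; apply: le_trans gT; lra.
Qed.
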